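(* Let $p$ be an odd prime and $i\in\{1,2\}$, and suppose $Q_i^p$ is non-empty. Then $$|C_i[p]|\le \min\{\operatorname{ord}_{A_i^q}(p) : q\in Q_i^p\},$$ and moreover $\min\{\operatorname{ord}_{A_i^q}(p) : q\in Q_i^p\}<p-1$.
   Context: Cunningham chain: for an odd prime $p$ and $i\in\{1,2\}$, set $a_n=2^{n-1}p+(-1)^{i+1}(2^{n-1}-1)$ for $n\ge1$ (so $a_1=p$ and $a_{n+1}=2a_n+(-1)^{i+1}$), let $k$ be the largest integer such that $a_1,\dots,a_k$ are all prime, and let $C_i[p]=\{a_1,\dots,a_k\}$ (so $|C_i[p]|=k$). Rogue sets: for an odd prime $q$, $A_i^q=(\mathbb{Z}/q\mathbb{Z})^\times\setminus\{(-1)^i \bmod q\}$. For $g\in A_i^q$ define $u_1=g$, $u_n=2u_{n-1}+(-1)^{i+1}$ in $\mathbb{Z}/q\mathbb{Z}$, $g_k^i=\min(\{n: u_n=0\}\cup\{\infty\})$, and the rogue sequence $\langle g\rangle_i^q=(u_n)_{1\le n<g_k^i}$. A rogue loop is a periodic rogue sequence (never reaching $0$). $q$ is a rogue prime if for some $i\in\{1,2\}$ some $\langle g\rangle_i^q$ with $g\in A_i^q$ is a rogue loop; otherwise $q$ is non-rogue (equivalently $2$ is a primitive root mod $q$). For non-rogue $q$, the rogue sequence $\langle(-1)^{i+1}\rangle_i^q=(u_1,\dots,u_{q-2})$ has underlying set exactly $A_i^q$ with distinct terms; for $x\in A_i^q$ let $k_x$ be the index with $u_{k_x}=x$, and define $\operatorname{ord}_{A_i^q}(x)=q-1-k_x$;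 for an integer $n$ with $n \bmod q\in A_i^q$, $\operatorname{ord}_{A_i^q}(n)$ means $\operatorname{ord}_{A_i^q}(n\bmod q)$. For $n\in\mathbb{N}$, $Q_i^n$ is the set of non-rogue odd primes $q<n$ such that $n\not\equiv(-1)^i \pmod q$ (i.e. such that $n \bmod q\in A_i^q$). *)

(* Defs.v *)
From HB Require Import structures.
From mathcomp Require Import all_boot all_order all_algebra finmap.
From mathcomp Require Import boolp classical_sets.
From mathcomp Require Import zify ring.
From mathcomp Require cyclic.

Set Implicit Arguments.
Unset Strict Implicit.
Unset Printing Implicit Defensive.

Import Order.TTheory GRing.Theory Num.Theory.
Local Open Scope classical_set_scope.
Local Open Scope ring_scope.

(* Both are 0 when the extremum does not exist; see nat_maxP, nat_minP and
   chain_lengthP. *)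
Definition nat_max (S : set nat) : nat :=
  xget 0%N [set m | S m /\ forall x, S x -> (x <= m)%N].

Definition nat_min (S : set nat) : nat :=
  xget 0%N [set m | S m /\ forall x, S x -> (m <= x)%N].

Definition primez (z : int) : bool := (0 <= z) && prime `|z|%N.

(* Only the indices n >= 1 are meaningful, here and in [rogue_term]. *)
Definition chain_term (i p n : nat) : int :=
  2 ^+ n.-1 * p%:Z + (-1) ^+ i.+1 * (2 ^+ n.-1 - 1).

Definition chain_length (i p : nat) : nat :=
  nat_max [set k | forall n : nat, (1 <= n <= k)%N -> primez (chain_term i p n)].

Definition cunningham_chain (i p : nat) : {fset int} :=
  [fset chain_term i p n | n in iota 1 (chain_length i p)]%fset.

Definition rogue_set (i q : nat) : {set 'Z_q} :=
  [set g : 'Z_q | (g \is a GRing.unit) && (g != (-1) ^+ i)]%SET.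

Definition rogue_term (i q : nat) (g : 'Z_q) (n : nat) : 'Z_q :=
  iter n.-1 (fun x : 'Z_q => 2 * x + (-1) ^+ i.+1) g.

(* The index g_k^i; [None] stands for infinity. *)
Definition rogue_end (i q : nat) (g : 'Z_q) : option nat :=
  match pselect (exists n : nat, (0 < n)%N && (rogue_term i g n == 0)) with
  | left ex0 => Some (ex_minn ex0)
  | right _ => None
  end.

Definition rogue_dom (i q : nat) (g : 'Z_q) (n : nat) : bool :=
  (0 < n)%N && (if rogue_end i g is Some k then (n < k)%N else true).

(* The sequence (u_n) for 1 <= n < g_k^i, as a partial function of n. *)
Definition rogue_seq (i q : nat) (g : 'Z_q) (n : nat) : option 'Z_q :=
  if rogue_dom i g n then Some (rogue_term i g n) else None.

Definition rogue_loop (i q : nat) (g : 'Z_q) : Prop :=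
  rogue_end i g = None /\
  exists2 T : nat, (0 < T)%N &
    forall n : nat, (0 < n)%N -> rogue_seq i g (n + T) = rogue_seq i g n.

Definition rogue_prime (q : nat) : Prop :=
  exists i : nat, (i = 1%N \/ i = 2%N) /\
    exists2 g : 'Z_q, g \in rogue_set i q & rogue_loop i g.

(* For q non-rogue and x in [rogue_set i q] this index exists and is unique. *)
Definition rogue_index (i q : nat) (x : 'Z_q) : nat :=
  xget 0%N [set k | rogue_seq i ((-1) ^+ i.+1 : 'Z_q) k = Some x].

Definition rogue_ord (i q : nat) (x : 'Z_q) : nat := (q - 1 - rogue_index i x)%N.

Definition Qset (i n : nat) : set nat :=
  [set q | [/\ prime q, odd q, ~ rogue_prime q, (q < n)%N
             & (n%:Z != (-1) ^+ i %[mod q%:Z])%Z]].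

Lemma nat_maxP (S : set nat) (b : nat) :
  (exists n, S n) -> (forall x, S x -> (x <= b)%N) ->
  S (nat_max S) /\ forall x, S x -> (x <= nat_max S)%N.
Proof.
move=> exS Sb; rewrite /nat_max; apply: (@xgetPex _ 0%N [set m | S m /\ _]).
have exS' : exists n, `[< S n >] by case: exS => n Sn; exists n; apply/asboolP.
have Sb' n : `[< S n >] -> (n <= b)%N by move=> /asboolP/Sb.
case: (ex_maxnP exS' Sb') => m /asboolP Sm max_m.
by exists m; split=> // x Sx; apply/max_m/asboolP.
Qed.

Lemma nat_minP (S : set nat) :
  (exists n, S n) ->
  S (nat_min S) /\ forall x, S x -> (nat_min S <= x)%N.
Proof.
move=> exS; rewrite /nat_min; apply: (@xgetPex _ 0%N [set m | S m /\ _]).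
have exS' : exists n, `[< S n >] by case: exS => n Sn; exists n; apply/asboolP.
case: (ex_minnP exS') => m /asboolP Sm min_m.
by exists m; split=> // x Sx; apply/min_m/asboolP.
Qed.

Lemma chain_term_pP (i p : nat) : prime p -> odd p ->
  ~~ primez (chain_term i p p).
Proof.
move=> p_pr p_odd; have p_gt2 : (2 < p)%N by rewrite odd_prime_gt2.
have cop2 : coprime 2 p by rewrite coprime2n.
have F1 : (p %| 2 ^ p.-1 - 1)%N.
  have := cyclic.Euler_exp_totient cop2; rewrite totient_prime // => /eqP.
  by rewrite eqn_mod_dvd ?expn_gt0.
have e2 : 2 ^+ p.-1 = (2 ^ p.-1)%:Z :> int by rewrite -natz natrX.
have big : (4 <= 2 ^ p.-1)%N by rewrite -[4%N]/(2 ^ 2)%N leq_exp2l //; lia.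
apply/negP => /andP[_ a_pr]; move: a_pr; rewrite /chain_term e2.
set N := (2 ^ p.-1)%N in F1 big *.
case/dvdnP: F1 => c Hc; have HN : N = (c * p + 1)%N by lia.
have [e ->] : exists e : bool, (-1) ^+ i.+1 = (if e then -1 else 1) :> int.
  by exists (odd i.+1); rewrite -signr_odd; case: odd.
have -> : (N%:Z * p%:Z + (if e then -1 else 1) * (N%:Z - 1)) =
  p%:Z * (N%:Z + (if e then -1 else 1) * c%:Z).
  by rewrite HN PoszD PoszM; case: e; ring.
rewrite abszM => /primeP[_ /(_ p)]; rewrite dvdn_mulr // => /(_ isT) /orP[].
  by lia.
rewrite absz_nat => /eqP; case: e; nia.
Qed.

Lemma chain_lengthP (i p : nat) : prime p -> odd p ->
  (forall n : nat, (1 <= n <= chain_length i p)%N -> primez (chain_term i p n))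
  /\ forall k : nat,
    (forall n : nat, (1 <= n <= k)%N -> primez (chain_term i p n)) ->
    (k <= chain_length i p)%N.
Proof.
move=> p_pr p_odd.
pose S := [set k | forall n : nat, (1 <= n <= k)%N -> primez (chain_term i p n)].
apply: (@nat_maxP S p).
  by exists 0%N => n; lia.
move=> k kP; rewrite leqNgt; apply/negP => ltpk.
have /negP := chain_term_pP i p_pr p_odd; apply; apply: kP.
by rewrite prime_gt0 // ltnW.
Qed.

(* Main.v *)
Require Import Defs.
From mathcomp Require Import all_boot all_order all_algebra finmap.
From mathcomp Require Import boolp classical_sets.
From mathcomp Require Import zify ring.
From mathcomp Require cyclic.

Import GRing.Theory.
Local Open Scope classical_set_scope.
Local Open Scope ring_scope.

(** Write s = (-1)^(i+1) and f(x) = 2x + s on Z/q, a bijection sending 0 to s.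
    For non-rogue q and x in A_i^q, the f-orbit of x reaches 0, hence s; as f is
    a permutation, x is conversely f^(K-1)(s) for some K < L, where L is the
    first index at which the sequence started at s vanishes, and L <= q - 1 by
    Fermat.  The chain reduces mod q to the f-orbit of p, so with x = p mod q
    its term of index L - K + 1 is divisible by q; it is at least p > q, so it
    is not prime. Hence the chain length is at most L - K <= q - 1 - K. *)

Lemma iter_fixed_mul (T : Type) (f : T -> T) (x : T) (L : nat) :
  iter L f x = x -> forall k, iter (k * L) f x = x.
Proof. by move=> fx; elim=> [|k IH] //; rewrite mulSn iterD IH. Qed.

(** An injective self-map of a finite type permutes it, so reachability under [f] is symmetric. *)
Lemma iter_inj_back (T : finType) (f : T -> T) (x y : T) (m : nat) :
  injective f -> iter m f x = y -> exists k, iter k f y = x.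
Proof.
move=> f_inj fxy; exists (findex f y x); apply: iter_findex.
by rewrite fconnect_sym // -fxy fconnect_iter.
Qed.

Section Modulus.

Variable q : nat.
Hypotheses (q_prime : prime q) (q_odd : odd q).

Let q_gt1 : (1 < q)%N := prime_gt1 q_prime.

Lemma natr_Zp_eq0 (n : nat) : ((n%:R : 'Z_q) == 0) = (q %| n)%N.
Proof. by rewrite -val_eqE /= val_Zp_nat. Qed.

Lemma intr_Zp_eq0 (z : int) : ((z%:~R : 'Z_q) == 0) = (q%:Z %| z)%Z.
Proof.
rewrite dvdzE absz_nat; case: z => n /=; first exact: natr_Zp_eq0.
by rewrite NegzE mulrNz oppr_eq0 natr_Zp_eq0.
Qed.

(** Names the anonymous step of [rogue_term], so that [rogue_termE] holds by conversion. *)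
Definition rogue_step (i : nat) (x : 'Z_q) : 'Z_q := 2 * x + (-1) ^+ i.+1.

Lemma rogue_step_inj (i : nat) : injective (rogue_step i).
Proof.
move=> x y /addIr; apply: mulrI.
by rewrite unitZpE // coprime_sym coprime2n.
Qed.

Lemma iter_rogue_step (i n : nat) (x : 'Z_q) :
  iter n (rogue_step i) x = 2 ^+ n * x + (-1) ^+ i.+1 * (2 ^+ n - 1).
Proof.
elim: n => [|n IH]; first by rewrite expr0 subrr mulr0 addr0 mul1r.
by rewrite iterS IH /rogue_step !exprS; ring.
Qed.

Lemma rogue_termE (i n : nat) (x : 'Z_q) :
  rogue_term i x n = iter n.-1 (rogue_step i) x.
Proof. by []. Qed.

Lemma chain_term_Zp (i p n : nat) :
  (chain_term i p n)%:~R = rogue_term i (p%:R : 'Z_q) n.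
Proof.
rewrite rogue_termE iter_rogue_step /chain_term.
by rewrite !(rmorphD, rmorphM, rmorphXn, rmorphN, rmorphB) ?rmorph1.
Qed.

(** With s = (-1)^(i+1), the [q.-2]-fold iterate at s is s(2^(q-1) - 1), which vanishes by
    Fermat. *)
Lemma rogue_term_sign_pred (i : nat) :
  rogue_term i ((-1) ^+ i.+1 : 'Z_q) q.-1 = 0.
Proof.
have cop2 : coprime 2 q by rewrite coprime2n.
have pow2 : 2 ^+ q.-1 = 1 :> 'Z_q.
  apply/eqP; rewrite -subr_eq0 -natrX -[1]/(1%:R) -natrB ?expn_gt0 // natr_Zp_eq0.
  rewrite -eqn_mod_dvd ?expn_gt0 //; apply/eqP.
  by rewrite -[in LHS](totient_prime q_prime) cyclic.Euler_exp_totient.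
have e : q.-1 = q.-2.+1 by have := odd_prime_gt2 q_odd q_prime; lia.
rewrite rogue_termE iter_rogue_step.
rewrite e exprS in pow2.
by transitivity ((-1) ^+ i.+1 * (2 * 2 ^+ q.-2 - 1) : 'Z_q);
  [ring | rewrite pow2 subrr mulr0].
Qed.

Lemma rogue_endP (i : nat) (x : 'Z_q) (m : nat) :
  rogue_term i x m.+1 = 0 ->
  exists L, [/\ rogue_end i x = Some L, (0 < L <= m.+1)%N
    & rogue_term i x L = 0].
Proof.
move=> xm0; rewrite /rogue_end; case: pselect => [ex0 | []]; last first.
  by exists m.+1; rewrite xm0 eqxx.
case: (ex_minnP ex0) => L /andP[L_gt0 /eqP xL0] L_min; exists L; split=> //.
by rewrite L_gt0 L_min // xm0 eqxx.
Qed.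

(** The step permutes a finite set, so the orbit of [x] is a cycle through [x], and its length is a
    period from the first term on. *)
Lemma rogue_loop_never0 (i : nat) (x : 'Z_q) :
  (forall n, iter n (rogue_step i) x != 0) -> rogue_loop i x.
Proof.
move=> x_n0.
have endN : rogue_end i x = None.
  rewrite /rogue_end; case: pselect => // ex0; exfalso; case: ex0 => n /andP[_].
  by rewrite rogue_termE (negPf (x_n0 _)).
split=> //; exists (fingraph.order (rogue_step i) x).
  exact: fingraph.order_gt0.
move=> n n_gt0; rewrite /rogue_seq /rogue_dom endN n_gt0 addn_gt0 n_gt0 /=.
rewrite !rogue_termE (_ : _.-1 = n.-1 + fingraph.order (rogue_step i) x)%N.
  by rewrite iterD iter_order //; apply: rogue_step_inj.
by case: n n_gt0.
Qed.

Lemma rogue_seq_sign_onto (i : nat) (x : 'Z_q) :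
  i = 1%N \/ i = 2%N -> ~ rogue_prime q -> x \in rogue_set i q ->
  exists k, rogue_seq i ((-1) ^+ i.+1 : 'Z_q) k = Some x.
Proof.
move=> hi q_nr xA; pose s : 'Z_q := (-1) ^+ i.+1.
have x_n0 : x != 0.
  by move: xA; rewrite inE => /andP[xu _]; apply: contraTneq xu => ->; rewrite unitr0.
have [m xm0] : exists m, iter m (rogue_step i) x = 0.
  apply: contrapT => no_m; apply: q_nr; exists i; split=> //.
  exists x => //; apply: rogue_loop_never0 => n.
  by apply/eqP => xn0; apply: no_m; exists n.
have step0 : rogue_step i 0 = s by rewrite /rogue_step mulr0 add0r.
have [k sk] : exists k, iter k (rogue_step i) s = x.
  (* One step past 0 is s, hence the exponent [m.+1]. *)
  apply: (@iter_inj_back _ _ _ _ m.+1); first exact: rogue_step_inj.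
  by rewrite iterS xm0.
have e : q.-1 = q.-2.+1 by have := odd_prime_gt2 q_odd q_prime; lia.
have := rogue_term_sign_pred i; rewrite e.
case/rogue_endP => L [endL /andP[L_gt0 _]]; rewrite rogue_termE -/s => sL0.
have sL : iter L (rogue_step i) s = s by rewrite -(prednK L_gt0) iterS sL0.
have sr : iter (k %% L) (rogue_step i) s = x.
  by rewrite -[RHS]sk [in RHS](divn_eq k L) addnC iterD iter_fixed_mul.
(* The residue [L - 1] would give [x = 0]; excluding it keeps the index inside the domain of the
   sequence. *)
have r_lt : ((k %% L).+1 < L)%N.
  have := ltn_pmod k L_gt0; rewrite leq_eqVlt => /orP[/eqP rL|] //.
  by move: x_n0; rewrite -sr -sL0 -[in L.-1]rL eqxx.
exists (k %% L).+1.
by rewrite /rogue_seq /rogue_dom -/s endL r_lt /= rogue_termE /= sr.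
Qed.

Lemma natr_in_rogue_set (i p : nat) :
  prime p -> (q < p)%N -> (p%:Z != (-1) ^+ i %[mod q%:Z])%Z ->
  (p%:R : 'Z_q) \in rogue_set i q.
Proof.
move=> p_prime lt_qp p_ne; rewrite inE unitZpE //; apply/andP; split.
  by rewrite prime_coprime // dvdn_prime2 // ltn_eqF.
apply: contra p_ne; rewrite -subr_eq0 eqz_mod_dvd -intr_Zp_eq0.
by rewrite rmorphB rmorphXn /= rmorphN1.
Qed.

End Modulus.

(** The term equals p + (2^(n-1) - 1)(p + s) with s = 1 or -1, and p + s is nonnegative. *)
Lemma chain_term_ge (i p n : nat) : (0 < p)%N -> p%:Z <= chain_term i p n.
Proof.
move=> p_gt0; rewrite /chain_term.
have -> : 2 ^+ n.-1 = (2 ^ n.-1)%:Z :> int by rewrite -natz natrX.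
have : (0 < 2 ^ n.-1)%N by rewrite expn_gt0.
by rewrite -signr_odd; case: odd; rewrite ?expr0 ?expr1; nia.
Qed.

(** A prime divisible by q equals q, but the term is at least p > q. *)
Lemma chain_term_not_prime (i p q n : nat) :
  prime q -> (q < p)%N -> (q%:Z %| chain_term i p n)%Z ->
  ~~ primez (chain_term i p n).
Proof.
move=> q_prime lt_qp q_dvd; apply/negP => /andP[_ a_prime].
have := @chain_term_ge i p n; move: q_dvd; rewrite dvdzE absz_nat.
rewrite dvdn_prime2 // => /eqP; lia.
Qed.

Lemma card_cunningham_chain (i p : nat) :
  (#|` cunningham_chain i p | <= chain_length i p)%N.
Proof.
rewrite /cunningham_chain; apply: leq_trans (leq_imfset_card _ _ _) _.
by rewrite /= (leq_trans (size_undup _)) ?size_iota.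
Qed.

Lemma chain_length_le_rogue_ord (i p q : nat) :
  prime p -> odd p -> i = 1%N \/ i = 2%N -> Qset i p q ->
  (chain_length i p <= rogue_ord i (p%:R : 'Z_q))%N.
Proof.
move=> p_prime p_odd hi [q_prime q_odd q_nr lt_qp p_ne].
have pA := natr_in_rogue_set _ q_prime _ _ p_prime lt_qp p_ne.
have := rogue_seq_sign_onto _ q_prime q_odd _ _ hi q_nr pA.
(* Existence of an index rules out the default value 0 of [xget]. *)
rewrite /rogue_ord => /(@xgetPex _ 0%N).
rewrite -/(rogue_index i (p%:R : 'Z_q)) /=.
move: (rogue_index _ _) => K.
have e : q.-1 = q.-2.+1 by have := odd_prime_gt2 q_odd q_prime; lia.
have := rogue_term_sign_pred _ q_prime q_odd i; rewrite e.
case/rogue_endP => L [endL /andP[L_gt0 L_le] sL0].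
rewrite /rogue_seq /rogue_dom endL; case: ifP => // /andP[K_gt0 lt_KL] [sK].
(* This suffices because L is at most q - 1. *)
suff : (chain_length i p <= L - K)%N by lia.
rewrite leqNgt; apply/negP => lt_len.
have [len_prime _] := chain_lengthP i p_prime p_odd.
have /len_prime : (1 <= (L - K).+1 <= chain_length i p)%N by [].
apply/negP; apply: (@chain_term_not_prime _ _ q) => //.
(* As p mod q is the K-th term of the sequence from s, L - K further steps lead to its L-th term,
   0. *)
rewrite -intr_Zp_eq0 // chain_term_Zp // -sK !rogue_termE -iterD.
by rewrite (_ : _ + K.-1 = L.-1)%N -?rogue_termE ?sL0 //=; lia.
Qed.

Theorem mainTheorem5 (p i : nat) (p_prime : prime p) (p_odd : odd p)
    (hi : i = 1%N \/ i = 2%N) (hQ : exists q : nat, Qset i p q) :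
  let ords : set nat := [set @rogue_ord i q (p%:R : 'Z_q) | q in Qset i p] in
  (#|` cunningham_chain i p | <= nat_min ords)%N
  /\ (nat_min ords < p - 1)%N.
Proof.
move=> ords.
(* The minimum is attained at some q, and both claims are proved for that q. *)
have [|[q Qq <-] _] := @nat_minP ords.
  by case: hQ => q Qq; exists (rogue_ord i (p%:R : 'Z_q)); exists q.
split; first exact: leq_trans (card_cunningham_chain i p)
  (chain_length_le_rogue_ord _ _ _ p_prime p_odd hi Qq).
(* The order is at most q - 1, and 0 < q < p makes q - 1 < p - 1 strict despite truncated
   subtraction. *)
by case: Qq => /prime_gt0 + _ _ + _; rewrite /rogue_ord; lia.
Qed.
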